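(* Let $\mathbb{F}_4$ be the field with $4$ elements. If $f\in\mathbb{F}_4[x]$ is a product of linear factors over $\mathbb{F}_4$ such that all of the coefficients of $x^0,x^1,\ldots,x^{\deg f}$ in $f$ are nonzero, then the base $4$ expansion of $\deg(f)+1$ has at most $4$ nonzero digits. Moreover, the value $4$ is attained by some such $f$. *)

(* Defs.v *)
From HB Require Import structures.
From mathcomp Require Import all_boot all_order all_algebra.
Set Implicit Arguments.
Unset Strict Implicit.
Unset Printing Implicit Defensive.

Import GRing.Theory.
Local Open Scope ring_scope.

(* For n > 0 the base b expansion of n has exactly (trunc_log b n).+1 digits,
   that of b ^ i being n %/ b ^ i %% b. *)
Definition nonzero_digits (b n : nat) : nat :=
  (\sum_(i < (trunc_log b n).+1) (n %/ b ^ i %% b != 0))%N.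

(* Only meaningful for f != 0. *)
Definition degree (R : nzRingType) (f : {poly R}) : nat := (size f).-1.

(* The relation %= allows a nonzero scalar factor; it also excludes f = 0. *)
Definition product_of_linear_factors (F : fieldType) (f : {poly F}) : Prop :=
  exists s : seq F, f %= \prod_(a <- s) ('X - a%:P).

Definition all_coefs_nonzero (R : nzRingType) (f : {poly R}) : Prop :=
  forall i : nat, (i <= degree f)%N -> f`_i != 0.

(* Main.v *)
Require Import Defs.
From HB Require Import structures.
From mathcomp Require Import all_boot all_order all_algebra.
From mathcomp Require Import all_field zify ring.
Set Implicit Arguments.
Unset Strict Implicit.
Unset Printing Implicit Defensive.

Import GRing.Theory.
Local Open Scope ring_scope.

(** Up to a scalar, f = prod_u (1 + u X)^(e_u) over the nonzero u in F_4.
Writing e_u = 4 e'_u + d_u with d_u < 4 and using the Frobenius,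
f(X) = g(X) h(X^4) with g = prod_u (1 + u X)^(d_u) and h = prod_u (1 + u X)^(e'_u).
For a set B of elements of F_4 containing 0, suppose that (1 + u X) f has no zero
coefficient for every u in B. Comparing the coefficients of index 4 j + r, the same
holds for h and the set B' of all the t such that the r-th section
q_r + q_(r+4) X of some q = (1 + u X) g is proportional to 1 + t X. A finite check
shows that if deg f >= 3 then 3 <= deg g <= 6, so that the lowest base 4 digit of deg f + 1 is deg g - 3,
and #B' >= #B, with strict inequality when that digit is nonzero. Since #B <= 4,
the number of nonzero digits is at most 5 - #B; the case B = {0} is the claim. *)

(** * Peeling off the last digit *)

Lemma nonzero_digits_divn (b n : nat) : (1 < b)%N -> (b <= n)%N ->
  nonzero_digits b n = ((n %% b != 0) + nonzero_digits b (n %/ b))%N.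
Proof.
move=> b_gt1 le_bn; have b_gt0 : (0 < b)%N by apply: ltnW.
have q_gt0 : (0 < n %/ b)%N by rewrite divn_gt0.
have log_n : trunc_log b n = (trunc_log b (n %/ b)).+1.
  apply: trunc_log_eq => //; apply/andP; split.
    by rewrite expnSr -leq_divRL // trunc_logP.
  by rewrite expnSr -ltn_divLR // trunc_log_ltn.
rewrite /nonzero_digits log_n big_ord_recl /= expn0 divn1; congr addn.
by apply: eq_bigr => i _; rewrite /bump /= add1n expnS divnMA.
Qed.

Lemma nonzero_digits_small (b n : nat) : (n < b)%N -> (nonzero_digits b n <= 1)%N.
Proof.
move=> lt_nb; rewrite /nonzero_digits (_ : trunc_log b n = 0%N).
  by rewrite big_ord_recl big_ord0 addn0 leq_b1.
by apply/eqP; rewrite trunc_log_eq0; lia.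
Qed.

(** * Polynomials without zero coefficients *)

(* For p != 0 this says that p has no zero coefficient up to its degree; unlike that
   formulation, it restricts to arithmetic progressions of indices with no degree
   bookkeeping. *)
Definition initial_support (R : nzRingType) (p : {poly R}) : Prop :=
  forall i j : nat, (i <= j)%N -> p`_i = 0 -> p`_j = 0.

Lemma initial_supportZ (R : idomainType) (c : R) (p : {poly R}) :
  c != 0 -> initial_support (c *: p) -> initial_support p.
Proof.
move=> c_n0 sup_cp i j le_ij pi0.
have := sup_cp i j le_ij; rewrite !coefZ pi0 mulr0 => /(_ erefl)/eqP.
by rewrite mulf_eq0 (negPf c_n0) => /eqP.
Qed.

Lemma all_coefs_nonzeroP (R : nzRingType) (p : {poly R}) :
  p != 0 -> all_coefs_nonzero p <-> initial_support p.
Proof.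
move=> p_n0; split=> [nz i j le_ij pi0|sup i le_i].
  have lt_i : (degree p < i)%N.
    by rewrite ltnNge; apply/negP => /nz; rewrite pi0 eqxx.
  by apply: nth_default; rewrite /degree in lt_i; case: (size p) lt_i => [|m] /=; lia.
apply/eqP => /(sup _ _ le_i)/eqP.
by rewrite -[p`_(degree p)]/(lead_coef p) lead_coef_eq0 (negPf p_n0).
Qed.

Lemma initial_support_neq0 (R : nzRingType) (p : {poly R}) (i : nat) :
  initial_support p -> (i < size p)%N -> p`_i != 0.
Proof.
move=> sup lt_i; apply/eqP => pi0; have le_i : (i <= (size p).-1)%N by lia.
have /eqP := sup _ _ le_i pi0; rewrite -[p`_(size p).-1]/(lead_coef p).
by rewrite lead_coef_eq0 -size_poly_eq0 => /eqP size_p; rewrite size_p in lt_i.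
Qed.

(** * Sections along arithmetic progressions *)

Definition section (R : nzRingType) (k r : nat) (p : {poly R}) : {poly R} :=
  \poly_(i < size p) p`_(k * i + r).

Lemma coef_section (R : nzRingType) (k r : nat) (p : {poly R}) (i : nat) :
  (0 < k)%N -> (section k r p)`_i = p`_(k * i + r).
Proof.
move=> k_gt0; rewrite coef_poly; case: ltnP => // le_i.
rewrite nth_default //; apply: leq_trans le_i _.
by rewrite (leq_trans (leq_pmull i k_gt0)) ?leq_addr.
Qed.

(** Only exponents divisible by k occur in h(X^k), so index k j + r sees only the coefficients of p
    in the class of r modulo k. The induction is on the Horner form of h: a factor X in h becomes a
    shift by k. *)
Lemma coef_mul_comp_Xn (R : comNzRingType) (k r : nat) (p h : {poly R}) (j : nat) :
  (r < k)%N -> (p * (h \Po 'X^k))`_(k * j + r) = (section k r p * h)`_j.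
Proof.
move=> lt_rk; have k_gt0 : (0 < k)%N by apply: leq_ltn_trans lt_rk.
elim/poly_ind: h j => [|h c IHh] j; first by rewrite comp_poly0 !mulr0 !coef0.
rewrite comp_polyD comp_polyM comp_polyX comp_polyC !mulrDr !mulrA !coefD.
rewrite !coefMC coefMXn coefMX coef_section //; congr (_ + _).
case: j => [|j] /=; first by rewrite muln0 add0n lt_rk.
rewrite (_ : (k * j.+1 + r < k)%N = false); last by nia.
by rewrite (_ : (k * j.+1 + r - k)%N = (k * j + r)%N) //; nia.
Qed.

(** * The field with four elements *)

(* A model of F_4 that computes: (a, b) stands for a + b w with w ^ 2 = w + 1. *)
Definition F4 : Type := (bool * bool)%type.
HB.instance Definition _ := Finite.on F4.

Definition F4add (x y : F4) : F4 := (x.1 (+) y.1, x.2 (+) y.2).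
Definition F4mul (x y : F4) : F4 :=
  ((x.1 && y.1) (+) (x.2 && y.2),
   (x.1 && y.2) (+) (x.2 && y.1) (+) (x.2 && y.2)).
Definition F4zero : F4 := (false, false).
Definition F4one : F4 := (true, false).
Definition F4gen : F4 := (false, true).
Definition F4gen' : F4 := (true, true).
Definition F4enum : seq F4 := [:: F4zero; F4one; F4gen; F4gen'].

Lemma F4_mulV (x : F4) : x != F4zero -> F4mul x (F4mul x x) = F4one.
Proof. by case: x => [[] []]. Qed.

Definition emb (R : nzRingType) (w : R) (x : F4) : R :=
  (nat_of_bool x.1)%:R + (nat_of_bool x.2)%:R * w.

Lemma emb0 (R : nzRingType) (w : R) : emb w F4zero = 0.
Proof. by rewrite /emb mul0r addr0. Qed.

Lemma emb1 (R : nzRingType) (w : R) : emb w F4one = 1.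
Proof. by rewrite /emb mul0r addr0. Qed.

Definition F4_generator (R : nzRingType) (w : R) : Prop :=
  2 \in [pchar R] /\ w ^+ 2 = w + 1.

Lemma embD (R : comNzRingType) (w : R) (x y : F4) : F4_generator w ->
  emb w (F4add x y) = emb w x + emb w y.
Proof.
move=> [/addrr_pchar2 ch2 w2]; rewrite /emb.
have e (a b : bool) : (a (+) b)%:R = a%:R + b%:R :> R.
  by case: a b => [] []; rewrite /= ?addr0 ?add0r ?ch2.
by rewrite /F4add /= !e; ring.
Qed.

Lemma embM (R : comNzRingType) (w : R) (x y : F4) : F4_generator w ->
  emb w (F4mul x y) = emb w x * emb w y.
Proof.
move=> [/addrr_pchar2 ch2 w2]; rewrite /emb.
have e (a b : bool) : (a (+) b)%:R = a%:R + b%:R :> R.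
  by case: a b => [] []; rewrite /= ?addr0 ?add0r ?ch2.
by rewrite /F4mul /= !e -!mulnb !natrM; ring: w2.
Qed.

(** A nonzero x satisfies x^3 = 1, so its image is a unit. *)
Lemma emb_eq0 (R : comNzRingType) (w : R) (x : F4) : F4_generator w ->
  (emb w x == 0) = (x == F4zero).
Proof.
move=> gen_w; apply/eqP/eqP => [ex0|->]; last exact: emb0.
apply/eqP/idPn => /F4_mulV/(congr1 (emb w)); rewrite embM // ex0 mul0r emb1.
by move/esym/eqP; rewrite oner_eq0.
Qed.

Lemma emb_inj (R : comNzRingType) (w : R) : F4_generator w -> injective (emb w).
Proof.
move=> gen_w x y exy; have : emb w (F4add x y) == 0.
  by rewrite embD // exy; case: gen_w => /addrr_pchar2->.
by rewrite emb_eq0 //; case: x y {exy} => [[] []] [[] []].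
Qed.

(** Every x satisfies x^4 = x. For x = -1 this gives -1 = 1; any w other than 0 and 1 is then a root
    of X^2 + X + 1, since X^4 - X = X (X - 1) (X^2 + X + 1). *)
Lemma F4_generator_exists (F : finFieldType) : #|F| = 4%N ->
  exists w : F, F4_generator w.
Proof.
move=> cardF; have x4 (x : F) : x ^+ 4 = x by rewrite -{2}(expf_card x) cardF.
have ch2 : 2 \in [pchar F].
  rewrite inE /=; apply/eqP; rewrite -[2%:R]/(1 + 1); apply/eqP.
  by rewrite addr_eq0 -[X in _ == X]x4 -[4%N]/(2 * 2)%N exprM sqrrN !expr1n.
have [w w_n0 w_n1] : exists2 w : F, w != 0 & w != 1.
  have /set0Pn[w] : ~: [set 0; 1 : F] != set0.
    by rewrite -card_gt0 cardsCs setCK cards2 cardF; case: (_ != _).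
  by rewrite !inE negb_or => /andP[]; exists w.
exists w; split=> //; apply/eqP; rewrite -subr_eq0.
have w3 : (w * (w - 1)) * (w ^+ 2 - (w + 1)) = 0.
  rewrite (_ : _ * _ = (w ^+ 4 - w) - (1 + 1) * (w ^+ 3 - w)); last by ring.
  by rewrite x4 (addrr_pchar2 ch2) subrr mul0r subrr.
by move/eqP: w3; rewrite !mulf_eq0 (negPf w_n0) [w - 1 == 0]subr_eq0 (negPf w_n1).
Qed.

(** * The finite check on coefficient lists *)

(* Coefficients, constant term first, of c + (1 + u X) s(X). *)
Fixpoint linmul_carry (u c : F4) (s : seq F4) : seq F4 :=
  if s is x :: s' then F4add c x :: linmul_carry u (F4mul u x) s' else [:: c].

Definition linmul (u : F4) (s : seq F4) : seq F4 := linmul_carry u F4zero s.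

Definition linpow (a b c : nat) : seq F4 :=
  iter a (linmul F4one) (iter b (linmul F4gen) (iter c (linmul F4gen') [:: F4one])).

Lemma size_linmul (u : F4) (s : seq F4) : size (linmul u s) = (size s).+1.
Proof. by rewrite /linmul; elim: s F4zero => //= x s IHs c; rewrite IHs. Qed.

Lemma size_linpow (a b c : nat) : size (linpow a b c) = (a + b + c).+1.
Proof.
have size_iter u n s : size (iter n (linmul u) s) = (n + size s)%N.
  by elim: n => //= n IHn; rewrite size_linmul IHn.
by rewrite !size_iter /= addn1 !addnS addnA.
Qed.

(* The quotient q_(r+4) / q_r, as x^-1 = x ^ 2 for x != 0. *)
Definition ratio (q : seq F4) (r : nat) : F4 :=
  F4mul (nth F4zero q (4 + r)) (F4mul (nth F4zero q r) (nth F4zero q r)).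

(** The set B' of the overview, possibly with repetitions; [good_step] therefore counts over
    [F4enum]. *)
Definition ratios (B : seq F4) (g : seq F4) : seq F4 :=
  [seq ratio (linmul u g) r | u <- B, r <- iota 0 4].

(** For r < 4 the coefficient of index r of q h(X^4) is q_r times the constant term of h; from index
    4 on, several coefficients of q mix. *)
Definition low_nonzero (B : seq F4) (g : seq F4) : bool :=
  all (fun u => all (fun r => nth F4zero (linmul u g) r != F4zero) (iota 0 4)) B.

Definition good_step (B : seq F4) (a b c : nat) : bool :=
  let g := linpow a b c in
  low_nonzero B g ==>
    [&& 3 <= a + b + c <= 6, F4zero \in ratios B g
      & size B + (a + b + c != 3) <= count (mem (ratios B g)) F4enum]%N.

(** There are eight sets containing 0 and 64 triples of exponents, so 512 cases are computed. *)
Lemma good_step_holds (P : pred F4) (a b c : nat) :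
  P F4zero -> (a < 4)%N -> (b < 4)%N -> (c < 4)%N ->
  good_step [seq u <- F4enum | P u] a b c.
Proof.
move=> P0; rewrite -[(a < 4)%N](mem_iota 0) -[(b < 4)%N](mem_iota 0).
rewrite -[(c < 4)%N](mem_iota 0) => a4 b4 c4.
have /allP/(_ a a4)/allP/(_ b b4)/allP/(_ c c4) // :
  all (fun a => all (fun b => all (good_step [seq u <- F4enum | P u] a b)
    (iota 0 4)) (iota 0 4)) (iota 0 4).
rewrite /= P0; case: (P F4one) (P F4gen) (P F4gen') => [] [] []; by vm_compute.
Qed.

(** * Products of linear factors and Frobenius *)

(** Normalised at the constant term, so that u = 0 gives the factor 1 and the choice B = {0} speaks
    of f itself. *)
Definition linfactor (R : nzRingType) (u : R) : {poly R} := 1 + u%:P * 'X.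

Definition embpoly (R : nzRingType) (w : R) (s : seq F4) : {poly R} :=
  Poly (map (emb w) s).

Lemma coef_embpoly (R : nzRingType) (w : R) (s : seq F4) (i : nat) :
  (embpoly w s)`_i = emb w (nth F4zero s i).
Proof.
rewrite coef_Poly; case: (ltnP i (size s)) => [lt_i|le_i].
  exact: nth_map.
by rewrite !nth_default ?size_map // emb0.
Qed.

Lemma embpoly_linmul (R : comNzRingType) (w : R) (u : F4) (s : seq F4) :
  F4_generator w ->
  embpoly w (linmul u s) = linfactor (emb w u) * embpoly w s.
Proof.
move=> gen_w; rewrite /linmul -[RHS]add0r.
(* The summand 0 becomes the image of the initial carry, so that the induction can run over an
   arbitrary carry. *)
rewrite -[X in X + _](_ : (emb w F4zero)%:P = 0); last by rewrite emb0 polyC0.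
rewrite /embpoly; elim: s F4zero => [|x s IHs] c /=.
  by rewrite cons_poly_def mul0r add0r mulr0 addr0.
rewrite !cons_poly_def IHs embD // embM // (polyCD (emb w c)) (polyCM (emb w u)).
by rewrite /linfactor; ring.
Qed.

Definition linprod (R : nzRingType) (w : R) (a b c : nat) : {poly R} :=
  linfactor (emb w F4one) ^+ a * linfactor (emb w F4gen) ^+ b
    * linfactor (emb w F4gen') ^+ c.

Lemma embpoly_linpow (R : comNzRingType) (w : R) (a b c : nat) :
  F4_generator w -> embpoly w (linpow a b c) = linprod w a b c.
Proof.
move=> gen_w.
have iterE u n s : embpoly w (iter n (linmul u) s)
    = linfactor (emb w u) ^+ n * embpoly w s.
  elim: n => [|n IHn]; first by rewrite mul1r.
  by rewrite iterS embpoly_linmul // IHn exprS mulrA.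
rewrite !iterE /embpoly /= cons_poly_def mul0r add0r emb1 polyC1 mulr1.
by rewrite /linprod emb1 mulrA.
Qed.

Lemma size_linfactor (R : idomainType) (u : R) : u != 0 -> size (linfactor u) = 2%N.
Proof.
move=> u_n0; rewrite /linfactor addrC size_polyDl mul_polyC size_scale ?size_polyX //.
by rewrite size_poly1.
Qed.

Lemma size_linprod (R : idomainType) (w : R) (a b c : nat) :
  F4_generator w -> size (linprod w a b c) = (a + b + c).+1.
Proof.
move=> gen_w; have s2 u : u != F4zero -> size (linfactor (emb w u)) = 2%N.
  by move=> u_n0; rewrite size_linfactor // emb_eq0.
have n0 u : u != F4zero -> linfactor (emb w u) != 0.
  by move=> /s2 s2u; rewrite -size_poly_gt0 s2u.
have sX u n : u != F4zero -> size (linfactor (emb w u) ^+ n) = n.+1.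
  by move=> u_n0; rewrite polySpred ?expf_neq0 ?n0 // size_exp s2 // mul1n.
by rewrite /linprod !size_mul ?mulf_neq0 ?expf_neq0 ?n0 // !sX // !addnS addSn.
Qed.

Lemma linprodM (R : comNzRingType) (w : R) (a b c a' b' c' : nat) :
  linprod w (a + a') (b + b') (c + c') = linprod w a b c * linprod w a' b' c'.
Proof. by rewrite /linprod !exprD; ring. Qed.

(** In characteristic 2 the fourth power is additive, and u^4 = u for u in F_4. *)
Lemma linfactor_exp4 (R : comNzRingType) (w : R) (u : F4) :
  F4_generator w ->
  linfactor (emb w u) ^+ 4 = linfactor (emb w u) \Po 'X^4.
Proof.
move=> gen_w; rewrite /linfactor exprDn_pchar; last first.
  by rewrite (eq_pnat _ (pcharf_eq (_ : 2 \in _))) // pchar_poly; case: gen_w.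
rewrite expr1n exprMn -polyC_exp comp_polyD comp_polyM comp_polyX !comp_polyC.
congr (1 + _%:P * _).
by rewrite (exprM _ 2 2) !expr2 -!embM //; case: u => [[] []].
Qed.

Lemma linprod_exp4 (R : comNzRingType) (w : R) (a b c : nat) :
  F4_generator w ->
  linprod w (4 * a) (4 * b) (4 * c) = linprod w a b c \Po 'X^4.
Proof.
move=> gen_w; rewrite /linprod !exprM !linfactor_exp4 // !comp_polyM.
by rewrite !(rmorphXn (comp_poly 'X^4)).
Qed.

(** * The descent from f to h *)

(** At most 8 coefficients leave only q_r and q_(r+4) in the section, and q_r^3 = 1 allows q_r to be
    factored out. *)
Lemma section_embpoly (R : comNzRingType) (w : R) (q : seq F4) (r : nat) :
  F4_generator w -> (size q <= 8)%N -> nth F4zero q r != F4zero ->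
  section 4 r (embpoly w q)
    = (emb w (nth F4zero q r))%:P * linfactor (emb w (ratio q r)).
Proof.
move=> gen_w size_q qr_n0; apply/polyP => i.
rewrite coef_section // coef_embpoly coefCM coefD coef1 coefCM coefX.
case: i => [|[|i]] /=.
- by rewrite muln0 add0n mulr0 addr0 mulr1.
- rewrite muln1 add0r mulr1 /ratio !embM // mulrCA -!embM // F4_mulV //.
  by rewrite embM // emb1 mulr1 addnC.
- rewrite mulr0 addr0 mulr0 nth_default ?emb0 //.
  by apply: leq_trans size_q _; lia.
Qed.

Lemma initial_support_section (R : comNzRingType) (k r : nat) (p h : {poly R}) :
  (r < k)%N -> initial_support (p * (h \Po 'X^k)) ->
  initial_support (section k r p * h).
Proof.
move=> lt_rk sup i j le_ij; rewrite -!coef_mul_comp_Xn //.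
by apply: sup; rewrite leq_add2r leq_mul2l le_ij orbT.
Qed.

(** Strong induction on the degree. [P] is the set B and stays general, because the step passes from
    B to B'. *)
Lemma nonzero_digits_linprod (R : idomainType) (w : R) (P : pred F4)
    (a b c : nat) :
  F4_generator w -> P F4zero ->
  (forall u, P u -> initial_support (linfactor (emb w u) * linprod w a b c)) ->
  (nonzero_digits 4 (a + b + c).+1 + count P F4enum <= 5)%N.
Proof.
move=> gen_w; have [n] := ubnP (a + b + c)%N.
elim: n P a b c => // n IHn P a b c lt_n P0 sup.
have [lt4|ge4] := ltnP (a + b + c).+1 4.
  by rewrite (leq_add (nonzero_digits_small lt4) (count_size P F4enum)).
pose g := linpow (a %% 4) (b %% 4) (c %% 4).
pose h := linprod w (a %/ 4) (b %/ 4) (c %/ 4).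
have factE u : linfactor (emb w u) * linprod w a b c
    = embpoly w (linmul u g) * (h \Po 'X^4).
  rewrite embpoly_linmul // embpoly_linpow // -linprod_exp4 // -mulrA -linprodM.
  by rewrite ![(_ %% 4 + _)%N]addnC ![(4 * _)%N]mulnC -!divn_eq.
have low : low_nonzero [seq u <- F4enum | P u] g.
  apply/allP => u; rewrite mem_filter => /andP[Pu _].
  apply/allP => r; rewrite mem_iota add0n => lt_r.
  (* The degree a + b + c is at least 3, so index r < 4 is within the size of the product, even for
     u = 0. *)
  have : (linfactor (emb w u) * linprod w a b c)`_r != 0.
    apply: initial_support_neq0 (sup u Pu) _; apply: leq_trans lt_r _.
    have L_n0 : linfactor (emb w u) != 0.
      apply/eqP => /(congr1 (coefp 0)) /= /eqP.
      by rewrite coefD coef1 coefCM coefX mulr0 addr0 coef0 oner_eq0.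
    have H_n0 : linprod w a b c != 0 by rewrite -size_poly_gt0 size_linprod.
    rewrite size_mul // size_linprod //.
    by rewrite (polySpred L_n0) addSn /= (leq_trans ge4) ?leq_addl.
  rewrite factE; apply: contraNneq => qr0.
  rewrite -[r]add0n -[X in (X + _)%N](muln0 4) coef_mul_comp_Xn //.
  by rewrite coefM big_ord1 coef_section // muln0 add0n coef_embpoly qr0 emb0 mul0r.
have := @good_step_holds P (a %% 4) (b %% 4) (c %% 4) P0.
rewrite !ltn_mod => /(_ isT isT isT).
rewrite /good_step -/g low => /and3P[/andP[d_ge3 d_le6] Q0 cntQ].
set d := (a %% 4 + b %% 4 + c %% 4)%N in d_ge3 d_le6 cntQ.
set N := (a %/ 4 + b %/ 4 + c %/ 4)%N.
(* As a + b + c = 4 N + d with 3 <= d <= 6, the last digit is d - 3 and the quotient is N + 1, which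
   is deg h + 1. *)
have degE : (a + b + c).+1 = (N.+1 * 4 + (d - 3))%N by rewrite /N /d; lia.
have digit_lt4 : (d - 3 < 4)%N by lia.
have lt_N : (N < n)%N by lia.
suff supQ u : u \in ratios [seq u <- F4enum | P u] g ->
    initial_support (linfactor (emb w u) * h).
  have := IHn (mem (ratios [seq u <- F4enum | P u] g)) _ _ _ lt_N Q0 supQ.
  rewrite (nonzero_digits_divn (isT : 1 < 4)%N ge4) degE modnMDl divnMDl //.
  rewrite (modn_small digit_lt4) (divn_small digit_lt4) addn0 -/N.
  rewrite size_filter in cntQ; rewrite (_ : (d - 3 != 0)%N = (d != 3)%N); last by lia.
  by apply: leq_trans; rewrite -addnA addnCA leq_add2l addnC.
case/allpairsP=> [[v r] [Pv]]; rewrite [(v, r).2]/= mem_iota add0n => lt_r ->.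
move: Pv; rewrite [(v, r).1]/= => Pv.
have qr_n0 : nth F4zero (linmul v g) r != F4zero.
  by move/allP: low => /(_ v Pv)/allP/(_ r); apply; rewrite mem_iota.
(* Section r of (1 + v X) f is q_r (1 + u X) h, where u is the ratio and q_r is nonzero. *)
move: Pv; rewrite mem_filter => /andP[/sup + _]; rewrite factE.
move/(initial_support_section lt_r).
rewrite section_embpoly //; last by rewrite size_linmul size_linpow.
rewrite -mulrA mul_polyC; apply: initial_supportZ.
by rewrite emb_eq0.
Qed.

(** * Reduction of f to the normal form *)

Lemma F4_emb_surj (F : finFieldType) (w : F) :
  #|F| = 4%N -> F4_generator w -> forall x : F, exists u : F4, x = emb w u.
Proof.
move=> cardF gen_w x.
have le_card : (#|F| <= #|{: F4}|)%N by rewrite cardF card_prod card_bool.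
by have /codomP[u ->] := inj_card_onto (emb_inj gen_w) le_card x; exists u.
Qed.

Lemma eqp_XsubC_linfactor (F : fieldType) (x : F) :
  x != 0 -> 'X - x%:P %= linfactor (- x^-1).
Proof.
move=> x_n0; rewrite (_ : 'X - _ = (- x) *: linfactor (- x^-1)).
  by rewrite eqp_scale ?oppr_eq0.
rewrite /linfactor -mul_polyC mulrDr mulr1 mulrA -polyCM mulrNN divff //.
by rewrite mul1r polyCN addrC.
Qed.

(** The nonzero constant term excludes the root 0, and for x != 0 the factor X - x is proportional
    to 1 - x^-1 X. *)
Lemma product_of_linear_factors_linprod (F : finFieldType) (w : F) (f : {poly F}) :
  #|F| = 4%N -> F4_generator w -> f`_0 != 0 -> product_of_linear_factors f ->
  exists a b c : nat, f %= linprod w a b c.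
Proof.
move=> cardF gen_w f0 [s f_s].
have s0 : 0 \notin s.
  apply: contra f0 => s_0; rewrite -horner_coef0 -/(root f 0).
  by rewrite (eqp_root f_s) root_prod_XsubC.
suff [a [b [c E]]] : exists a b c, \prod_(x <- s) ('X - x%:P) %= linprod w a b c.
  by exists a, b, c; apply: eqp_trans f_s E.
elim: s s0 {f_s} => [|x s IHs].
  by exists 0%N, 0%N, 0%N; rewrite big_nil /linprod !expr0 !mulr1 eqpxx.
rewrite inE negb_or eq_sym => /andP[x_n0 /IHs[a [b [c E]]]].
have [u ux] := F4_emb_surj cardF gen_w (- x^-1).
have u_n0 : u != F4zero by rewrite -(emb_eq0 _ gen_w) -ux oppr_eq0 invr_eq0.
have {E} : \prod_(y <- x :: s) ('X - y%:P) %= linfactor (emb w u) * linprod w a b c.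
  rewrite big_cons -ux; apply: eqp_trans (eqp_mull _ E) _; apply: eqp_mulr.
  exact: eqp_XsubC_linfactor.
(* The remaining values of u come in the order 1 + w, 1, w, so the exponents c, a, b grow in
   turn. *)
by case: u {ux} u_n0 => [[] []] // _ E; [exists a, b, c.+1 | exists a.+1, b, c
  | exists a, b.+1, c]; move: E; rewrite /linprod exprS; congr (_ %= _); ring.
Qed.

(** * Checking the extremal example *)

Lemma product_of_linear_factorsM (F : fieldType) (p q : {poly F}) :
  product_of_linear_factors p -> product_of_linear_factors q ->
  product_of_linear_factors (p * q).
Proof.
move=> [s p_s] [t q_t]; exists (s ++ t); rewrite big_cat /=.
exact: eqp_trans (eqp_mulr _ p_s) (eqp_mull _ q_t).
Qed.

Lemma product_of_linear_factorsX (F : fieldType) (p : {poly F}) (n : nat) :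
  product_of_linear_factors p -> product_of_linear_factors (p ^+ n).
Proof.
move=> p_lin; elim: n => [|n IHn]; first by exists [::]; rewrite big_nil eqpxx.
by rewrite exprS; apply: product_of_linear_factorsM.
Qed.

Lemma product_of_linear_factors_linfactor (F : fieldType) (u : F) :
  u != 0 -> product_of_linear_factors (linfactor u).
Proof.
move=> u_n0; exists [:: - u^-1]; rewrite big_seq1 eqp_sym.
rewrite (_ : linfactor u = linfactor (- (- u^-1)^-1)).
  by apply: eqp_XsubC_linfactor; rewrite oppr_eq0 invr_eq0.
by rewrite invrN invrK opprK.
Qed.

(** For an explicit product this leaves a membership test in a list, decided by computation. *)
Lemma all_coefs_nonzero_embpoly (R : comNzRingType) (w : R) (s : seq F4) :
  F4_generator w -> s != [::] -> F4zero \notin s -> all_coefs_nonzero (embpoly w s).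
Proof.
move=> gen_w s_n0 s0 i le_i; rewrite coef_embpoly emb_eq0 //.
apply: contraNneq s0 => <-; apply: mem_nth; apply: leq_ltn_trans le_i _.
have := size_Poly (map (emb w) s); rewrite size_map -/(embpoly w s) /degree.
by case: s s_n0 {i} => // x s _; case: (size (embpoly _ _)).
Qed.

Theorem mainTheorem3 (F : finFieldType) (cardF : #|F| = 4%N) :
  (forall f : {poly F},
     product_of_linear_factors f -> all_coefs_nonzero f ->
     (nonzero_digits 4 (degree f + 1) <= 4)%N) /\
  (exists f : {poly F},
     [/\ product_of_linear_factors f, all_coefs_nonzero f
       & nonzero_digits 4 (degree f + 1) = 4%N]).
Proof.
have [w gen_w] := F4_generator_exists cardF; split=> [f f_prod f_nz|].
  have f0 := f_nz 0%N (leq0n _).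
  have [a [b [c f_abc]]] := product_of_linear_factors_linprod cardF gen_w f0 f_prod.
  rewrite /degree (eqp_size f_abc) size_linprod // addn1.
  (* The added 1 is the size of B = {0}. *)
  rewrite -(leq_add2r 1).
  apply: (@nonzero_digits_linprod _ w (pred1 F4zero)) => //= u /eqP->.
  rewrite /linfactor emb0 mul0r addr0 mul1r.
  have f_n0 : f != 0 by apply: contraNneq f0 => ->; rewrite coef0.
  have /eqpf_eq[k k_n0 fE] := f_abc.
  apply: (@initial_supportZ _ k) => //; rewrite -fE.
  exact/all_coefs_nonzeroP.
(* Degree 100, and 101 = 1211 in base 4. *)
exists (linprod w 32 37 31); split.
- have lin u : u != F4zero -> product_of_linear_factors (linfactor (emb w u)).
    by move=> u_n0; apply: product_of_linear_factors_linfactor; rewrite emb_eq0.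
  apply: product_of_linear_factorsM; first apply: product_of_linear_factorsM;
    by apply: product_of_linear_factorsX; apply: lin.
- by rewrite -embpoly_linpow //; apply: all_coefs_nonzero_embpoly.
- have -> : (degree (linprod w 32 37 31) + 1)%N = 101%N.
    by rewrite /degree size_linprod.
  (* The quotients are 25, 6, 1, with remainders 1, 1, 2. *)
  do 3 (rewrite nonzero_digits_divn; [|by []|by []]).
  by rewrite /nonzero_digits trunc_log1 big_ord1.
Qed.
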